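(* Let $M$ be a compact Riemannian manifold of dimension $d\ge 1$, let $f:M\to M$ be a $C^1$ map, and let $\Lambda\subseteq M$ be a compact invariant set which contains no critical points of $f$. Suppose that the tangent bundle over $\Lambda$ admits a continuous decomposition $T_\Lambda M=E^1_\Lambda\oplus E^2_\Lambda$ into $Df$-invariant subbundles, with $E^1_\Lambda$ not the zero bundle. Then $$\inf\mathcal L^1(f)\in\mathcal L^1(f).$$
   Context: Invariant means $f(\Lambda)\subseteq\Lambda$. A point $x$ is a critical point of $f$ if $\det Df_x=0$. The decomposition is $Df$-invariant if $Df_x(E^i_x)\subseteq E^i_{f(x)}$ for all $x\in\Lambda$ and $i=1,2$; continuous means that the subspaces $E^1_x,E^2_x$ depend continuously on $x\in\Lambda$. No hyperbolicity is assumed in either direction, and $E^2_\Lambda$ may be trivial. $\mathcal L^1(f)$ denotes the set of Lyapunov exponents of $f$ on $\Lambda$ in the direction of $E^1$: the set of all $\lambda\in\mathbb R$ for which there exist a point $x\in\Lambda$ and a nonzero vector $v\in E^1_x$ such that the limit $\lim_{n\to\infty}\frac1n\log\|Df^n_x(v)\|$ exists and equals $\lambda$. *)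

(* Defs.v *)
From HB Require Import structures.
From mathcomp Require Import all_boot all_order all_algebra.
From mathcomp Require Import all_classical all_reals all_analysis.
Set Implicit Arguments.
Unset Strict Implicit.
Unset Printing Implicit Defensive.
Import Order.TTheory GRing.Theory Num.Theory.
Import numFieldNormedType.Exports.
Local Open Scope classical_set_scope.
Local Open Scope ring_scope.

(* MathComp-Analysis has no manifolds:
   this file sets up smooth manifolds without boundary, Riemannian metrics and
   tangent maps.

   Tangent vectors.  Every point x has a preferred chart chart_at x, and the
   tangent space at x is identified with R^d (row vectors) by that chart: the
   vector v stands for the tangent vector at x whose coordinates in chart_at x
   are v.  Linear maps between tangent spaces are matrices acting on the right
   of row vectors. *)

(* The class C^k, for k finite, on an open set U (the definition is meaningful
   for open U only).  For k > 0, continuity of f itself follows from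
   differentiability. *)
Fixpoint Ck (R : realType) (d : nat) (V : normedModType R) (k : nat)
    (f : 'rV[R]_d -> V) (U : set 'rV[R]_d) : Prop :=
  match k with
  | 0%N => forall y, U y -> {for y, continuous f}
  | k'.+1 => (forall y, U y -> differentiable f y) /\
             (forall j : 'I_d, Ck k' (fun y => 'D_(delta_mx 0 j) f y) U)
  end.

Definition smooth (R : realType) (d : nat) (V : normedModType R)
    (f : 'rV[R]_d -> V) (U : set 'rV[R]_d) : Prop :=
  forall k, Ck k f U.

(* Both coordinate functions are total; their values outside source and target
   are irrelevant. *)
Record chart (R : realType) (d : nat) (M : topologicalType) := Chart {
  source : set M;
  target : set 'rV[R]_d;
  to_coord :> M -> 'rV[R]_d;
  of_coord : 'rV[R]_d -> M;
  source_open : open source;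
  target_open : open target;
  to_coord_target : forall x, source x -> target (to_coord x);
  of_coord_source : forall y, target y -> source (of_coord y);
  to_coordK : forall x, source x -> of_coord (to_coord x) = x;
  of_coordK : forall y, target y -> to_coord (of_coord y) = y;
  to_coord_continuous : {within source, continuous to_coord};
  of_coord_continuous : {within target, continuous of_coord} }.

(* The atlas need not be maximal. *)
Record smoothManifold (R : realType) (d : nat) := SmoothManifold {
  carrier :> topologicalType;
  carrier_hausdorff : hausdorff_space carrier;
  carrier_second_countable : @second_countable carrier;
  atlas : set (chart R d carrier);
  chart_at : carrier -> chart R d carrier;
  chart_at_atlas : forall x, atlas (chart_at x);
  chart_at_source : forall x, source (chart_at x) x;
  atlas_compatible : forall e e', atlas e -> atlas e' ->
    smooth (e' \o of_coord e) [set y | target e y /\ source e' (of_coord e y)] }.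

(* The matrix taking coordinates in e of a tangent vector at x to its
   coordinates in e'. *)
Definition coord_change (R : realType) (d : nat) (M : topologicalType)
    (e e' : chart R d M) (x : M) : 'M[R]_d :=
  jacobian (e' \o of_coord e) (e x).

(* metric x is the Gram matrix of the inner product on the tangent space at x
   in the coordinates of chart_at x.  As chart_at need not depend continuously
   on the point, smoothness is asked of the Gram matrices in the coordinates of
   a fixed chart e. *)
Record riemannianMetric (R : realType) (d : nat) (M : smoothManifold R d) :=
  RiemannianMetric {
  metric :> M -> 'M[R]_d;
  metric_sym : forall x, (metric x)^T = metric x;
  metric_pos : forall x (v : 'rV[R]_d), v != 0 ->
    0 < (v *m metric x *m v^T) 0 0;
  metric_smooth : forall e, atlas e ->
    smooth (fun y => let x := of_coord e y in
                     let J := coord_change e (chart_at x) x in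
                     J *m metric x *m J^T)
           (target e) }.

Definition riemannian_norm (R : realType) (d : nat) (M : smoothManifold R d)
    (g : riemannianMetric M) (x : M) (v : 'rV[R]_d) : R :=
  Num.sqrt ((v *m g x *m v^T) 0 0).

Definition C1_map (R : realType) (d : nat) (M : smoothManifold R d)
    (f : M -> M) : Prop :=
  continuous f /\
  forall e e' : chart R d M, atlas e -> atlas e' ->
    Ck 1 (e' \o f \o of_coord e)
       [set y | target e y /\ source e' (f (of_coord e y))].

(* The matrix of the differential of f at x, from the tangent space at x to the
   tangent space at f x: it maps v to v *m tangent_map f x. *)
Definition tangent_map (R : realType) (d : nat) (M : smoothManifold R d)
    (f : M -> M) (x : M) : 'M[R]_d :=
  jacobian (chart_at (f x) \o f \o of_coord (chart_at x)) (chart_at x x).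

Definition critical_point (R : realType) (d : nat) (M : smoothManifold R d)
    (f : M -> M) (x : M) : Prop :=
  \det (tangent_map f x) = 0.

(* E x depends continuously on x in L: around every point of L there is a local
   frame of E over L, continuous in the coordinates of a fixed chart. *)
Definition continuous_subbundle (R : realType) (d : nat)
    (M : smoothManifold R d) (L : set M) (E : M -> {vspace 'rV[R]_d}) : Prop :=
  forall x0, L x0 ->
    exists (U : set M) (r : nat) (s : 'I_r -> M -> 'rV[R]_d),
      [/\ open_nbhs x0 U,
          U `<=` source (chart_at x0),
          forall i, {within L `&` U, continuous (s i)} &
          forall x, (L `&` U) x ->
            basis_of (E x)
              [seq s i x *m coord_change (chart_at x0) (chart_at x) x
              | i : 'I_r]].

Definition invariant_subbundle (R : realType) (d : nat)
    (M : smoothManifold R d) (f : M -> M) (L : set M)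
    (E : M -> {vspace 'rV[R]_d}) : Prop :=
  forall x, L x -> forall v, v \in E x -> v *m tangent_map f x \in E (f x).

(* Without critical points of f in an invariant set L the norm below never
   vanishes for v != 0, so the convention ln 0 = 0 plays no role. *)
Definition lyapunov_exponents (R : realType) (d : nat) (M : smoothManifold R d)
    (g : riemannianMetric M) (f : M -> M) (L : set M)
    (E : M -> {vspace 'rV[R]_d}) : set R :=
  [set lambda | exists (x : M) (v : 'rV[R]_d),
    [/\ L x, v \in E x, v != 0 &
        (fun n : nat => n%:R^-1 *
           ln (riemannian_norm g (iter n f x) (v *m tangent_map (iter n f) x)))
          @ \oo --> lambda]].

(* Main.v *)
Require Import Defs.
From HB Require Import structures.
From mathcomp Require Import all_boot all_order all_algebra.
From mathcomp Require Import all_classical all_reals all_analysis.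
From mathcomp Require Import lra.
Import Order.TTheory GRing.Theory Num.Theory.
Import numFieldNormedType.Exports.
Local Open Scope classical_set_scope.
Local Open Scope ring_scope.
Set Implicit Arguments.
Unset Strict Implicit.
Unset Printing Implicit Defensive.

(** Write u_n(x, v) = ln |Df^n_x v| - ln |v| for x in Lambda and v a nonzero
vector of E^1_x.  These numbers are additive along orbits of the skew product
(x, v) |-> (f x, Df_x v): u_(m+n)(z) = u_m(z) + u_n(F^m z).  They do not
change when v is scaled, and depend continuously on (x, v).  The pairs (x, direction
of v) form a compact space, the projectivization of E^1, so the theorem is a
case of ergodic optimization, which has an elementary proof without invariant
measures.

Let alpha be the supremum of the uniform growth rates: of the a with u_n(z) >= n a - C for some C and all z and n.  No
exponent is smaller than alpha.  Suppose that each z has some n > 0 with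
u_n(z) > n alpha.  By compactness the times n can be bounded by a common N, and
the rate alpha improved to alpha + e for a common e > 0; cutting an orbit into
stretches of length at most N along which the rate is at least alpha + e
([growth_rate_concat]) makes alpha + e a uniform rate, which contradicts the
choice of alpha.  Hence some z satisfies u_n(z) <= n alpha for all n > 0; as
every a < alpha is a uniform rate, u_n(z) / n tends to alpha, and alpha is the
least exponent ([optimal_orbit]).

What remains is to see compactness and continuity through charts.  Tangent
vectors at x are written in the preferred chart of x, which may vary wildly
with x, so continuity can only be read off in a fixed chart: the chain rule
([chart_derivative_comp]) moves all coordinate changes into one chart at the
source and one at the target ([riemannian_norm_tangent_cvg]).  The
projectivized bundle is never topologized; compactness of Lambda and compactness
of the unit sphere of coefficients in a local frame are used one inside the
other ([uniform_on_directions]). *)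

(** * Locality of derivatives, the Jacobian chain rule, limits of matrices *)
Lemma near_eq_diff_expansion (K : numFieldType) (V W : normedModType K)
    (f h : V -> W) (x : V) :
  differentiable f x -> (\forall y \near x, f y = h y) ->
  h \o shift x = cst (h x) + 'd f x +o_ 0 id.
Proof.
move=> /diff_locallyP[_ fE] fh.
apply/eqaddoP => e e0.
have /eqaddoP /(_ e e0) fe := fE.
have fh0 : \forall z \near (0 : V), f (z + x) = h (z + x).
  have sh : (fun z : V => z + x) @ (0 : V) --> x.
    have -> : x = 0 + x by rewrite add0r.
    rewrite [in X in X --> _]add0r.
    by apply: cvgD; [exact: cvg_id|exact: cvg_cst].
  exact: sh _ fh.
have hx : h x = f x by apply/esym/(nbhs_singleton fh).
apply: filterS2 fh0 fe => z fhz; rewrite /= !fctE /= hx -fhz; exact.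
Qed.

Lemma near_eq_diff (K : numFieldType) (V W : normedModType K)
    (f h : V -> W) (x : V) :
  differentiable f x -> (\forall y \near x, f y = h y) ->
  'd h x = 'd f x :> (V -> W).
Proof.
move=> df fh; apply: diff_unique; first exact: diff_continuous.
exact: near_eq_diff_expansion.
Qed.

Lemma near_eq_differentiable (K : numFieldType) (V W : normedModType K)
    (f h : V -> W) (x : V) :
  differentiable f x -> (\forall y \near x, f y = h y) -> differentiable h x.
Proof.
move=> df fh; apply/diff_locallyP; rewrite (near_eq_diff df fh).
by split; [exact: diff_continuous|exact: near_eq_diff_expansion].
Qed.

Lemma jacobianE (R : realType) m n (f : 'rV[R]_m -> 'rV[R]_n) x i :
  differentiable f x -> row i (jacobian f x) = 'D_(delta_mx 0 i) f x.
Proof. by move=> df; rewrite (deriveEjacobian _ df) -rowE. Qed.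

Lemma near_eq_jacobian (R : realType) m n (f h : 'rV[R]_m -> 'rV[R]_n) x :
  differentiable f x -> (\forall y \near x, f y = h y) ->
  jacobian h x = jacobian f x.
Proof.
move=> df fh; have dh := near_eq_differentiable df fh.
apply/row_matrixP => i; apply: etrans (jacobianE i dh) _.
apply: etrans _ (esym (jacobianE i df)).
apply: etrans (deriveE _ dh) _; apply: etrans _ (esym (deriveE _ df)).
exact: (congr1 (fun u => u (delta_mx 0 i)) (near_eq_diff df fh)).
Qed.

Lemma jacobian_comp (R : realType) m n p (f : 'rV[R]_m -> 'rV[R]_n)
    (h : 'rV[R]_n -> 'rV[R]_p) x :
  differentiable f x -> differentiable h (f x) ->
  jacobian (h \o f) x = jacobian f x *m jacobian h (f x).
Proof.
move=> df dh; have dhf := differentiable_comp df dh.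
apply/row_matrixP => i; apply: etrans (jacobianE i dhf) _.
apply: etrans (deriveE _ dhf) _.
apply: etrans (congr1 (fun u => u (delta_mx 0 i)) (diff_comp df dh)) _.
apply: esym; apply: etrans (row_mul _ _ _) _.
apply: etrans (congr1 (mulmx^~ _) (jacobianE i df)) _.
apply: etrans (congr1 (mulmx^~ _) (deriveE _ df)) _.
apply: etrans (esym (deriveEjacobian _ dh)) _.
exact: deriveE.
Qed.

Lemma near_eq_cvg_to {T : Type} {U : topologicalType} {F : set_system T}
    {FF : Filter F} (f h : T -> U) (a b : U) :
  (\forall x \near F, f x = h x) -> a = b -> f @ F --> a -> h @ F --> b.
Proof. by move=> fh <-; apply: cvg_trans; exact: near_eq_cvg. Qed.

Section MatrixLimits.
Context {I : Type} {F : set_system I} {FF : Filter F}.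

Lemma cvg_mx_entries (T : topologicalType) m n (A : I -> 'M[T]_(m, n))
    (a : 'M[T]_(m, n)) :
  (forall i j, (fun x => A x i j) @ F --> a i j) -> A @ F --> a.
Proof.
move=> Aa U [P aP PU].
have : \forall x \near F, forall i j, P i j (A x i j).
  apply: filter_forall => i; apply: filter_forall => j.
  exact: Aa (aP i j).
by apply: filterS => x; exact: PU.
Qed.

Lemma cvg_mx_entry (R : realType) m n (A : I -> 'M[R]_(m, n))
    (a : 'M[R]_(m, n)) i j :
  A @ F --> a -> (fun x => A x i j) @ F --> a i j.
Proof. by move=> Aa; exact: (cvg_comp _ _ Aa (@coord_continuous _ _ _ i j a)). Qed.

Lemma cvg_mulmx (R : realType) m n p (A : I -> 'M[R]_(m, n)) (B : I -> 'M[R]_(n, p))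
    (a : 'M[R]_(m, n)) (b : 'M[R]_(n, p)) :
  A @ F --> a -> B @ F --> b -> (fun x => A x *m B x) @ F --> a *m b.
Proof.
move=> Aa Bb; apply: cvg_mx_entries => i j; rewrite mxE.
under eq_fun do rewrite mxE.
apply: cvg_big => [|k _]; first exact: add_continuous.
apply: cvgM.
  exact: cvg_mx_entry.
exact: cvg_mx_entry.
Qed.

Lemma cvg_trmx (R : realType) m n (A : I -> 'M[R]_(m, n))
    (a : 'M[R]_(m, n)) :
  A @ F --> a -> (fun x => (A x)^T) @ F --> a^T.
Proof.
move=> Aa; apply: cvg_mx_entries => i j; rewrite mxE.
under eq_fun do rewrite mxE.
exact: cvg_mx_entry.
Qed.

End MatrixLimits.

Lemma compact_sphere (R : realType) r : compact [set c : 'rV[R]_r | `|c| = 1].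
Proof.
apply: bounded_closed_compact.
  by exists 1; split=> // x x1 c /= ->; exact: ltW.
have -> : [set c : 'rV[R]_r | `|c| = 1] = Num.norm @^-1` [set x | x = 1] by [].
by apply: closed_comp => [c _|]; [exact: norm_continuous|exact: closed_eq].
Qed.

(** * Continuously differentiable maps between coordinate spaces *)
Section C1At.
Context {R : realType}.

(** A pointwise form of [Ck 1], free of any domain, so that it composes and can be
transported along local equality. *)
Definition C1_at m n (F : 'rV[R]_m -> 'rV[R]_n) (y : 'rV[R]_m) : Prop :=
  (\forall z \near y, differentiable F z) /\ {for y, continuous (jacobian F)}.

Lemma C1_at_differentiable m n (F : 'rV[R]_m -> 'rV[R]_n) y :
  C1_at F y -> differentiable F y.
Proof. by move=> [/nbhs_singleton]. Qed.

Lemma Ck1_C1_at d n (F : 'rV[R]_d -> 'rV[R]_n) (U : set 'rV[R]_d) :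
  open U -> Ck 1 F U <-> (forall y, U y -> C1_at F y).
Proof.
move=> oU; split=> [[dF cF] y Uy|C1F].
  have Uy' : \forall z \near y, U z by exact: open_nbhs_nbhs.
  split; first by apply: filterS Uy' => z; exact: dF.
  apply: (@cvg_mx_entries _ (nbhs y) _) => i j.
  have : ('D_(delta_mx 0 i) F z 0 j) @[z --> y] --> 'D_(delta_mx 0 i) F y 0 j.
    exact: (cvg_comp _ _ (cF i y Uy) (@coord_continuous _ _ _ 0 j _)).
  have JE z : differentiable F z -> 'D_(delta_mx 0 i) F z 0 j = jacobian F z i j.
    by move=> dFz; rewrite -(jacobianE i dFz) [LHS]mxE.
  apply: (@near_eq_cvg_to _ _ (nbhs y) _); last exact: JE (dF y Uy).
  by apply: filterS Uy' => z Uz; exact: JE (dF z Uz).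
split=> [y /C1F/C1_at_differentiable//|j y Uy].
have [dF JF] := C1F y Uy.
have : (delta_mx 0 j : 'rV[R]_d) *m jacobian F z @[z --> y] -->
    (delta_mx 0 j : 'rV[R]_d) *m jacobian F y.
  by apply: (@cvg_mulmx _ (nbhs y) _); [exact: cvg_cst|exact: JF].
apply: (@near_eq_cvg_to _ _ (nbhs y) _).
  by apply: filterS dF => z dFz; exact: esym (deriveEjacobian _ dFz).
exact: esym (deriveEjacobian _ (nbhs_singleton dF)).
Qed.

Lemma near_eq_C1_at m n (F G : 'rV[R]_m -> 'rV[R]_n) y :
  C1_at F y -> (\forall z \near y, F z = G z) -> C1_at G y.
Proof.
move=> [dF JF] FG.
have FG2 : \forall z \near y, \forall t \near z, F t = G t.
  exact/nbhs_interior.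
split.
  by apply: filterS2 dF FG2 => z dFz; exact: near_eq_differentiable.
have JFG := esym (near_eq_jacobian (nbhs_singleton dF) FG).
apply: (@near_eq_cvg_to _ _ (nbhs y) _) JFG JF.
by apply: filterS2 dF FG2 => z dFz FGz; exact: esym (near_eq_jacobian dFz FGz).
Qed.

Lemma C1_at_comp m n p (F : 'rV[R]_m -> 'rV[R]_n) (G : 'rV[R]_n -> 'rV[R]_p) y :
  C1_at F y -> C1_at G (F y) -> C1_at (G \o F) y.
Proof.
move=> C1F C1G; have dFy := C1_at_differentiable C1F.
have dGy := C1_at_differentiable C1G.
have cF : F z @[z --> y] --> F y by exact: differentiable_continuous.
have [dF JF] := C1F; have [dG JG] := C1G.
have dGF : \forall z \near y, differentiable G (F z) by exact: cF _ dG.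
split; first by apply: filterS2 dF dGF => z; exact: differentiable_comp.
have : jacobian F z *m jacobian G (F z) @[z --> y] -->
    jacobian F y *m jacobian G (F y).
  by apply: (@cvg_mulmx _ (nbhs y) _); [exact: JF|exact: cvg_comp cF JG].
apply: (@near_eq_cvg_to _ _ (nbhs y) _) (esym (jacobian_comp dFy dGy)).
by apply: filterS2 dF dGF => z dFz dGz; exact: esym (jacobian_comp dFz dGz).
Qed.

Lemma jacobian_id n (y : 'rV[R]_n) : jacobian id y = 1%:M.
Proof.
have did : differentiable (id : 'rV[R]_n -> 'rV[R]_n) y by [].
apply/row_matrixP => i; apply: etrans (jacobianE i did) _.
by rewrite derive_id rowE mulmx1.
Qed.

End C1At.

(** * C^1 maps of manifolds and the chain rule for tangent maps *)
Section Charts.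
Context {R : realType} {d : nat} {M : smoothManifold R d}.
Implicit Types (e : chart R d M) (f h : M -> M) (x : M).

Lemma chart_cvg e x : source e x -> e z @[z --> x] --> e x.
Proof.
move=> ex; have := @to_coord_continuous _ _ _ e.
by rewrite continuous_open_subspace; [apply; rewrite inE|exact: source_open].
Qed.

Lemma of_coord_cvg e y : target e y ->
  of_coord e z @[z --> y] --> of_coord e y.
Proof.
move=> ey; have := @of_coord_continuous _ _ _ e.
by rewrite continuous_open_subspace; [apply; rewrite inE|exact: target_open].
Qed.

Lemma near_source e x : source e x -> \forall z \near x, source e z.
Proof. by move=> ex; apply: open_nbhs_nbhs; split=> //; exact: source_open. Qed.

Lemma near_target e x : source e x -> \forall y \near e x, target e y.
Proof.
move=> ex; apply: open_nbhs_nbhs; split; first exact: target_open.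
exact: to_coord_target.
Qed.

Lemma of_coord_cvg_source e x : source e x ->
  of_coord e y @[y --> e x] --> x.
Proof.
move=> ex; rewrite -[X in _ --> X](to_coordK ex).
by apply: of_coord_cvg; exact: to_coord_target.
Qed.

Lemma open_chart_domain e e' f : continuous f ->
  open [set y | target e y /\ source e' (f (of_coord e y))].
Proof.
move=> cf; rewrite openE => y [ey e'y]; apply: filterI.
  by apply: open_nbhs_nbhs; split=> //; exact: target_open.
have : f (of_coord e z) @[z --> y] --> f (of_coord e y).
  exact: cvg_comp (of_coord_cvg ey) (cf _).
by apply; exact: near_source.
Qed.

(** Both [tangent_map], for the preferred charts, and [coord_change], for the
identity map, are instances. *)
Definition chart_derivative e e' f x : 'M[R]_d :=
  jacobian (e' \o f \o of_coord e) (e x).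

Lemma C1_mapP f : C1_map f <-> continuous f /\
  forall e e' x, atlas e -> atlas e' -> source e x -> source e' (f x) ->
    C1_at (e' \o f \o of_coord e) (e x).
Proof.
split=> [[cf C1f]|[cf C1f]]; split=> //.
  move=> e e' x ae ae' ex e'x.
  have /(Ck1_C1_at _ (open_chart_domain cf)) := C1f e e' ae ae'; apply.
  by split; [exact: to_coord_target|rewrite to_coordK].
move=> e e' ae ae'; apply/(Ck1_C1_at _ (open_chart_domain cf)) => y [ey e'y].
by have := C1f _ _ _ ae ae' (of_coord_source ey) e'y; rewrite of_coordK.
Qed.

Lemma C1_map_id : C1_map (@id M).
Proof.
split=> [x|e e' ae ae']; first exact: cvg_id.
by have := atlas_compatible ae ae' 1%N.
Qed.

(** Inserting a chart at the intermediate point changes a composition in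
coordinates only where [of_coord e1] fails to invert [e1], hence not near the
point: this is why derivatives have to be local. *)
Lemma near_comp_charts e e1 e' f h x : continuous f ->
  source e x -> source e1 (f x) ->
  \forall y \near e x, ((e' \o h \o of_coord e1) \o (e1 \o f \o of_coord e)) y =
    (e' \o (h \o f) \o of_coord e) y.
Proof.
move=> cf ex e1x.
have fe : f (of_coord e y) @[y --> e x] --> f x.
  exact: cvg_comp (of_coord_cvg_source ex) (cf x).
have : \forall y \near e x, source e1 (f (of_coord e y)).
  exact: fe _ (near_source e1x).
apply: filterS => y e1y.
by rewrite /= to_coordK.
Qed.

Lemma C1_map_comp f h : C1_map f -> C1_map h -> C1_map (h \o f).
Proof.
move=> /C1_mapP[cf C1f] /C1_mapP[ch C1h]; apply/C1_mapP; split.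
  by move=> x; apply: continuous_comp; [exact: cf|exact: ch].
move=> e e' x ae ae' ex e'x.
have a1 := chart_at_atlas (f x); have s1 := chart_at_source (f x).
apply: near_eq_C1_at (near_comp_charts _ _ cf ex s1).
apply: C1_at_comp; first exact: C1f.
by rewrite /= to_coordK//; exact: C1h.
Qed.

Lemma C1_map_iter n f : C1_map f -> C1_map (iter n f).
Proof.
by move=> C1f; elim: n => [|n IH]; [exact: C1_map_id|exact: C1_map_comp].
Qed.

Lemma chart_derivative_comp e e1 e' f h x : C1_map f -> C1_map h ->
  atlas e -> atlas e1 -> atlas e' ->
  source e x -> source e1 (f x) -> source e' (h (f x)) ->
  chart_derivative e e' (h \o f) x =
  chart_derivative e e1 f x *m chart_derivative e1 e' h (f x).
Proof.
move=> /C1_mapP[cf C1f] /C1_mapP[ch C1h] ae ae1 ae' ex e1x e'x.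
have df := C1_at_differentiable (C1f _ _ _ ae ae1 ex e1x).
have dh := C1_at_differentiable (C1h _ _ _ ae1 ae' e1x e'x).
have ee1 : e1 (f x) = (e1 \o f \o of_coord e) (e x) by rewrite /= to_coordK.
rewrite /chart_derivative; rewrite ee1 in dh *.
apply: etrans _ (jacobian_comp df dh).
apply: near_eq_jacobian (differentiable_comp df dh) _.
exact: near_comp_charts.
Qed.

Lemma tangent_map_comp f h x : C1_map f -> C1_map h ->
  tangent_map (h \o f) x = tangent_map f x *m tangent_map h (f x).
Proof.
by move=> C1f C1h; apply: chart_derivative_comp => //;
  solve [exact: chart_at_atlas|exact: chart_at_source].
Qed.

Lemma tangent_map_id x : tangent_map id x = 1%:M.
Proof.
rewrite -(jacobian_id (chart_at x x)); apply: near_eq_jacobian => //.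
apply: filterS (near_target (chart_at_source x)) => y ey.
by rewrite /= of_coordK.
Qed.

(** Both sides are the derivative of [h] from the chart [e] to the preferred chart
of [h x].  On the right, the only factor that involves a chart depending on the
point is the last one, which the metric absorbs. *)
Lemma coord_change_tangent_map e e' h x : C1_map h ->
  atlas e -> atlas e' -> source e x -> source e' (h x) ->
  coord_change e (chart_at x) x *m tangent_map h x =
  chart_derivative e e' h x *m coord_change e' (chart_at (h x)) (h x).
Proof.
move=> C1h ae ae' ex e'x; have C1id := C1_map_id.
transitivity (chart_derivative e (chart_at (h x)) h x).
  by rewrite -(@chart_derivative_comp e (chart_at x) (chart_at (h x)) id h x)//;
    solve [exact: chart_at_atlas|exact: chart_at_source].
by rewrite (@chart_derivative_comp e e' (chart_at (h x)) h id x)//;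
  solve [exact: chart_at_atlas|exact: chart_at_source].
Qed.

Lemma chart_derivative_cvg e e' h x : C1_map h ->
  atlas e -> atlas e' -> source e x -> source e' (h x) ->
  chart_derivative e e' h z @[z --> x] --> chart_derivative e e' h x.
Proof.
move=> /C1_mapP[ch C1h] ae ae' ex e'x.
have [_ J] := C1h _ _ _ ae ae' ex e'x.
exact: cvg_comp (chart_cvg ex) J.
Qed.

End Charts.

(** * The Riemannian norm along a C^1 map, in fixed charts *)
Section TangentNorm.
Context {R : realType} {d : nat} {M : smoothManifold R d}.
Variable g : riemannianMetric M.

Lemma riemannian_norm_gt0 x (v : 'rV[R]_d) :
  v != 0 -> 0 < riemannian_norm g x v.
Proof. by move=> v0; rewrite sqrtr_gt0; exact: metric_pos. Qed.

Lemma riemannian_normZ x (k : R) (v : 'rV[R]_d) :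
  riemannian_norm g x (k *: v) = `|k| * riemannian_norm g x v.
Proof.
rewrite /riemannian_norm linearZ /= -scalemxAr -!scalemxAl scalerA mxE.
by rewrite sqrtrM ?sqr_ge0// sqrtr_sqr.
Qed.

Definition chart_gram (e : chart R d M) (x : M) : 'M[R]_d :=
  coord_change e (chart_at x) x *m g x *m (coord_change e (chart_at x) x)^T.

Lemma chart_gram_cvg (e : chart R d M) x : atlas e -> source e x ->
  chart_gram e z @[z --> x] --> chart_gram e x.
Proof.
move=> ae ex.
have := metric_smooth g ae 0%N _ (to_coord_target ex).
move=> /(cvg_comp _ _ (chart_cvg ex)).
apply: (@near_eq_cvg_to _ _ (nbhs x) _).
  by apply: filterS (near_source ex) => z ez; rewrite /= to_coordK.
by rewrite to_coordK.
Qed.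

Lemma riemannian_norm_chart e x (w : 'rV[R]_d) :
  riemannian_norm g x (w *m coord_change e (chart_at x) x) =
  Num.sqrt ((w *m chart_gram e x *m w^T) 0 0).
Proof. by rewrite /riemannian_norm /chart_gram trmx_mul !mulmxA. Qed.

(** The norm of the image under [h] of the vector with coordinates [W] in a fixed
chart is a continuous function of [X] and [W]: in fixed charts at both ends it
is the square root of a quadratic form in [W] whose matrix depends continuously
on [X].  The limit is along an arbitrary filter, so that the base point may be
restricted to a subset and parameters may be added. *)
Lemma riemannian_norm_tangent_cvg {I : Type} {F : set_system I} {FF : Filter F}
    (X : I -> M) (W : I -> 'rV[R]_d) (e : chart R d M) (h : M -> M)
    (x0 : M) (w0 : 'rV[R]_d) :
  C1_map h -> atlas e -> source e x0 -> X @ F --> x0 -> W @ F --> w0 ->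
  (fun i => riemannian_norm g (h (X i))
     (W i *m coord_change e (chart_at (X i)) (X i) *m tangent_map h (X i)))
  @ F --> riemannian_norm g (h x0)
     (w0 *m coord_change e (chart_at x0) x0 *m tangent_map h x0).
Proof.
move=> C1h ae ex0 Xx0 Ww0.
pose e' := chart_at (h x0).
have ae' : atlas e' by exact: chart_at_atlas.
have e'x0 : source e' (h x0) by exact: chart_at_source.
have ch : h z @[z --> x0] --> h x0 by have [+ _] := C1h; apply.
pose W' x w : 'rV[R]_d := w *m chart_derivative e e' h x.
pose q x w := Num.sqrt ((W' x w *m chart_gram e' (h x) *m (W' x w)^T) 0 0).
have normE x w : source e x -> source e' (h x) -> riemannian_norm g (h x)
    (w *m coord_change e (chart_at x) x *m tangent_map h x) = q x w.
  move=> ex e'x; rewrite -mulmxA (coord_change_tangent_map C1h ae ae' ex e'x).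
  by rewrite mulmxA riemannian_norm_chart.
have cW' : (fun i => W' (X i) (W i)) @ F --> W' x0 w0.
  apply: cvg_mulmx => //.
  exact: cvg_comp Xx0 (chart_derivative_cvg C1h ae ae' ex0 e'x0).
have cG : (fun i => chart_gram e' (h (X i))) @ F --> chart_gram e' (h x0).
  exact: cvg_comp (cvg_comp _ _ Xx0 ch) (chart_gram_cvg ae' e'x0).
have cq : (fun i => q (X i) (W i)) @ F --> q x0 w0.
  apply: (@cvg_comp _ _ _ _ (@Num.sqrt R)); last exact: sqrt_continuous.
  apply: cvg_mx_entry; apply: cvg_mulmx; last exact: cvg_trmx.
  exact: cvg_mulmx.
apply: near_eq_cvg_to cq; last by rewrite normE.
have n1 : \forall i \near F, source e (X i) by exact: Xx0 _ (near_source ex0).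
have n2 : \forall i \near F, source e' (h (X i)).
  exact: (cvg_comp _ _ Xx0 ch) _ (near_source e'x0).
by apply: filterS2 n1 n2 => i ex e'x; rewrite normE.
Qed.

End TangentNorm.

(** * Orbits of least average growth *)
Lemma cvg_natrV (R : realType) : (fun n : nat => n%:R^-1 : R) @ \oo --> (0 : R).
Proof.
apply/cvgrPdist_le => e e0; near=> n.
have n0 : 0 < n%:R :> R by rewrite ltr0n; near: n; exact: nbhs_infty_gt.
rewrite sub0r normrN ger0_norm ?invr_ge0 ?ler0n//.
rewrite -[leRHS]invrK lef_pV2 ?posrE ?invr_gt0//.
by near: n; exact: nbhs_infty_ger.
Unshelve. all: by end_near. Qed.

Section OptimalOrbit.
Context {R : realType} {X : Type}.
Variables (S : set X) (F : X -> X) (l : X -> R).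
Hypothesis S_stable : forall z, S z -> S (F z).

Definition increment (n : nat) (z : X) : R := l (iter n F z) - l z.

Lemma incrementD m n z :
  increment (m + n) z = increment m z + increment n (iter m F z).
Proof. by rewrite /increment addnC iterD [RHS]addrC addrA subrK. Qed.

Lemma iter_stable n z : S z -> S (iter n F z).
Proof. by move=> Sz; elim: n => //= n; exact: S_stable. Qed.

Lemma increment_bound B :
  (forall z, S z -> `|increment 1 z| <= B) ->
  forall n z, S z -> `|increment n z| <= n%:R * B.
Proof.
move=> B1; elim=> [|n IH] z Sz; first by rewrite mul0r /increment subrr normr0.
rewrite -addn1 incrementD (le_trans (ler_normD _ _))// natrD mulrDl mul1r.
by apply: lerD; [exact: IH|apply: B1; exact: iter_stable].
Qed.

(** The constant [C] is what makes the property insensitive to finitely many steps,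
hence provable by concatenation. *)
Definition growth_rate (a : R) : Prop :=
  exists C, forall z n, S z -> n%:R * a - C <= increment n z.

(** Cut the orbit of [z] into stretches of length at most [N], each growing at
rate at least [b]; only the last, incomplete stretch can be worse, and its loss
is bounded because it has at most [N] steps. *)
Lemma growth_rate_concat B b N :
  (forall z, S z -> `|increment 1 z| <= B) ->
  (forall z, S z -> exists n, [/\ (0 < n)%N, (n <= N)%N &
     n%:R * b <= increment n z]) ->
  growth_rate b.
Proof.
move=> /increment_bound incB H; exists (N%:R * (`|b| + `|B|)) => z n.
have [k] := ubnP n; elim: k => // k IH in z n * => nk Sz.
have [nN|Nn] := leqP n N.
  have := incB n _ Sz; rewrite ler_norml => /andP[+ _]; apply: le_trans.
  rewrite lerBlDr -lerBlDl opprK -mulrDr.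
  apply: (@le_trans _ _ (n%:R * (`|b| + `|B|))).
    by rewrite ler_wpM2l// lerD// ler_norm.
  by rewrite ler_wpM2r ?ler_nat// addr_ge0.
(* The first stretch has length m; the induction covers the rest of the orbit. *)
have [m [m0 mN bm]] := H _ Sz.
have mn : (m <= n)%N by rewrite (leq_trans mN)// ltnW.
rewrite -(subnKC mn) incrementD natrD mulrDl -addrA lerD//.
apply: IH; last exact: iter_stable.
by rewrite -ltnS (leq_trans _ nk)// !ltnS ltn_subrL m0 (leq_trans m0 mn).
Qed.

Lemma increment_average_cvg z (lambda : R) :
  (fun n => n%:R^-1 * increment n z) @ \oo --> lambda <->
  (fun n => n%:R^-1 * l (iter n F z)) @ \oo --> lambda.
Proof.
have l0 : (fun n : nat => n%:R^-1 * l z) @ \oo --> (0 : R).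
  rewrite -[X in _ --> X](mul0r (l z)).
  by apply: cvgM; [exact: cvg_natrV|exact: cvg_cst].
split=> cv.
- have -> : (fun n => n%:R^-1 * l (iter n F z)) =
      (fun n => n%:R^-1 * increment n z + n%:R^-1 * l z).
    by apply/funext => n; rewrite -mulrDr subrK.
  by rewrite -[lambda]addr0; exact: cvgD.
- have -> : (fun n => n%:R^-1 * increment n z) =
      (fun n => n%:R^-1 * l (iter n F z) - n%:R^-1 * l z).
    by apply/funext => n; rewrite -mulrBr.
  by rewrite -[lambda]subr0; exact: cvgB.
Qed.

Lemma growth_rate_le_limit a z lambda : growth_rate a -> S z ->
  (fun n => n%:R^-1 * increment n z) @ \oo --> lambda -> a <= lambda.
Proof.
move=> [C aC] Sz zl.
have aCn : (fun n : nat => a - n%:R^-1 * C) @ \oo --> a.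
  rewrite -[X in _ --> X]subr0 -[in X in _ --> X](mul0r C).
  by apply: cvgB; [exact: cvg_cst|apply: cvgM; [exact: cvg_natrV|exact: cvg_cst]].
apply: (ler_cvg_to aCn zl); near=> n.
have n0 : 0 < n%:R :> R by rewrite ltr0n; near: n; exact: nbhs_infty_gt.
by rewrite ler_pdivlMl// mulrBr mulVKf ?gt_eqF// aC.
Unshelve. all: by end_near. Qed.

(** The last hypothesis is the form in which compactness enters: strict growth
faster than [a] at some time, for every point, is uniform in the time and in the
gain.  With [a] the supremum of the growth rates it would give a better growth
rate, so some orbit never gets ahead of this supremum. *)
Theorem optimal_orbit B :
  S !=set0 ->
  (forall z, S z -> `|increment 1 z| <= B) ->
  (forall a, (forall z, S z -> exists2 n, (0 < n)%N & n%:R * a < increment n z) ->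
    exists N e, 0 < e /\ forall z, S z -> exists n,
      [/\ (0 < n)%N, (n <= N)%N & n%:R * (a + e) <= increment n z]) ->
  exists alpha,
    (exists2 z, S z & (fun n => n%:R^-1 * l (iter n F z)) @ \oo --> alpha) /\
    (forall z lambda, S z ->
      (fun n => n%:R^-1 * l (iter n F z)) @ \oo --> lambda -> alpha <= lambda).
Proof.
move=> [z0 Sz0] incB uniform.
have incnB := increment_bound incB.
have rateP : has_sup [set a | growth_rate a].
  split.
    exists (- B), 0 => z n Sz; rewrite subr0 mulrN.
    by have := incnB n z Sz; rewrite ler_norml => /andP[].
  exists (B + 1) => a [C aC]; rewrite leNgt; apply/negP => Ba.
  have [n _ nC] : exists2 n : nat, (0 < n)%N & C < n%:R.
    exists (Num.trunc `|C|).+1 => //.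
    by rewrite (le_lt_trans (ler_norm _))// truncnS_gt.
  have := aC z0 n Sz0; rewrite leNgt => /negP; apply.
  have := incnB n _ Sz0; rewrite ler_norml => /andP[_ +].
  move=> /le_lt_trans; apply.
  rewrite ltrBrDl (lt_le_trans (y := n%:R + n%:R * B))// ?ltrD2r//.
  by rewrite -[X in X + _]mulr1 -mulrDr ler_wpM2l// addrC ltW.
set alpha := sup [set a | growth_rate a].
have [z [Sz zle]] : exists z, S z /\
    forall n, (0 < n)%N -> increment n z <= n%:R * alpha.
  apply: contrapT => /forallNP nz.
  have [z Sz|N [e [e0 /(growth_rate_concat incB) rate_e]]] := uniform alpha.
    apply: contrapT => zn; apply: (nz z); split=> // n n0.
    by rewrite leNgt; apply/negP => ?; apply: zn; exists n.
  have := sup_upper_bound rateP rate_e.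
  by rewrite -/alpha gerDl leNgt e0.
exists alpha; split; last first.
  move=> z' lambda Sz' /increment_average_cvg z'l.
  apply: ge_sup; first by case: rateP.
  by move=> a /growth_rate_le_limit; apply; eauto.
exists z => //; apply/increment_average_cvg/cvgrPdist_le => e e0.
have e20 : 0 < e / 2 by rewrite divr_gt0.
have [a [C aC] aalpha] := sup_adherent e20 rateP.
rewrite -/alpha in aalpha.
near=> n.
have n0 : 0 < n%:R :> R by rewrite ltr0n; near: n; exact: nbhs_infty_gt.
have up : n%:R^-1 * increment n z <= alpha.
  by rewrite ler_pdivrMl// zle// -(ltr0n R).
rewrite ger0_norm ?subr_ge0// lerBlDr -lerBlDl.
apply: (@le_trans _ _ (a - n%:R^-1 * C)).
  rewrite [in leLHS](splitr e) opprD addrA; apply: lerB; first exact: ltW.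
  rewrite ler_pdivrMl// -ler_pdivrMr//.
  by near: n; exact: nbhs_infty_ger.
by rewrite ler_pdivlMl// mulrBr mulVKf ?gt_eqF// aC.
Unshelve. all: by end_near. Qed.

End OptimalOrbit.

(** * The tangent dynamics on a subbundle *)
Section TangentDynamics.
Context {R : realType} {d : nat} {M : smoothManifold R d}.
Variables (g : riemannianMetric M) (f : M -> M).
Hypothesis f_C1 : C1_map f.

Definition nonzero_vectors (L : set M) (E : M -> {vspace 'rV[R]_d}) :
    set (M * 'rV[R]_d) :=
  [set z | [/\ L z.1, z.2 \in E z.1 & z.2 != 0]].

Definition tangent_step (z : M * 'rV[R]_d) : M * 'rV[R]_d :=
  (f z.1, z.2 *m tangent_map f z.1).

Definition log_norm (z : M * 'rV[R]_d) : R := ln (riemannian_norm g z.1 z.2).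

Lemma iter_tangent_step n z :
  iter n tangent_step z = (iter n f z.1, z.2 *m tangent_map (iter n f) z.1).
Proof.
elim: n => [|n IH]; first by rewrite tangent_map_id mulmx1; case: z.
apply: etrans (congr1 tangent_step IH) _.
apply: (congr1 (pair (f (iter n f z.1)))).
apply: etrans (esym (mulmxA _ _ _)) _.
apply: (congr1 (mulmx z.2)).
exact: esym (tangent_map_comp z.1 (C1_map_iter n f_C1) f_C1).
Qed.

Lemma log_norm_iterE n z : log_norm (iter n tangent_step z) =
  ln (riemannian_norm g (iter n f z.1) (z.2 *m tangent_map (iter n f) z.1)).
Proof. exact: (congr1 log_norm (iter_tangent_step n z)). Qed.

Lemma tangent_step_stable (L : set M) (E : M -> {vspace 'rV[R]_d}) :
  f @` L `<=` L -> (forall x, L x -> ~ critical_point f x) ->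
  invariant_subbundle f L E ->
  forall z, nonzero_vectors L E z -> nonzero_vectors L E (tangent_step z).
Proof.
move=> fL Lnc fE [x v] [/= Lx Ev v0]; split=> /=.
- by apply: fL; exists x.
- exact: fE.
- have T : tangent_map f x \in unitmx.
    by rewrite unitmxE unitfE; apply/eqP; exact: Lnc.
  by apply: contra v0 => /eqP vT0; rewrite -(mulmxK T v) vT0 mul0mx.
Qed.

Lemma log_normZ x (k : R) (v : 'rV[R]_d) : k != 0 -> v != 0 ->
  log_norm (x, k *: v) = ln `|k| + log_norm (x, v).
Proof.
move=> k0 v0; rewrite /log_norm /= riemannian_normZ lnM// posrE ?normr_gt0//.
exact: riemannian_norm_gt0.
Qed.

Lemma log_norm_iter_cvg {I : Type} {F : set_system I} {FF : Filter F} n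
    (X : I -> M) (W : I -> 'rV[R]_d) (e : chart R d M) (x0 : M) (w0 : 'rV[R]_d) :
  let z x w := (x, w *m coord_change e (chart_at x) x) in
  atlas e -> source e x0 -> X @ F --> x0 -> W @ F --> w0 ->
  (iter n tangent_step (z x0 w0)).2 != 0 ->
  (fun i => log_norm (iter n tangent_step (z (X i) (W i)))) @ F -->
    log_norm (iter n tangent_step (z x0 w0)).
Proof.
move=> z ae ex0 Xx0 Ww0 zn0.
pose N x w := riemannian_norm g (iter n f x)
  (w *m coord_change e (chart_at x) x *m tangent_map (iter n f) x).
have lE x w : log_norm (iter n tangent_step (z x w)) = ln (N x w).
  exact: log_norm_iterE.
apply: (near_eq_cvg_to (f := fun i => ln (N (X i) (W i))) _ (esym (lE x0 w0))).
  by apply: nearW => i; exact: esym (lE _ _).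
have cN : (fun i => N (X i) (W i)) @ F --> N x0 w0.
  exact: riemannian_norm_tangent_cvg (C1_map_iter n f_C1) ae ex0 Xx0 Ww0.
have N0 : 0 < N x0 w0.
  by apply: riemannian_norm_gt0; rewrite iter_tangent_step in zn0.
exact: cvg_comp cN (continuous_ln N0).
Qed.

(** The coefficients with respect to a continuous frame trivialize the bundle near
[x0].  Independence of the frame at [x0] turns nonzero coefficients into a
nonzero vector to start the dynamics from. *)
Lemma local_frame (L : set M) (E : M -> {vspace 'rV[R]_d}) x0 :
  continuous_subbundle L E -> L x0 ->
  exists (r : nat) (W : M -> 'M[R]_(r, d)),
    let vec x c := c *m W x *m coord_change (chart_at x0) (chart_at x) x in
    [/\ W x @[x --> within L (nbhs x0)] --> W x0,
        forall c, c != 0 -> vec x0 c \in E x0 /\ vec x0 c != 0 &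
        \forall x \near x0, L x -> forall v, v \in E x -> exists c, v = vec x c].
Proof.
move=> cE Lx0; have [U [r [s [oU _ cs bs]]]] := cE _ Lx0.
have [_ Ux0] := oU.
pose W x : 'M[R]_(r, d) := \matrix_(i < r) s i x.
exists r, W => vec.
pose b x i := s i x *m coord_change (chart_at x0) (chart_at x) x.
have vecE x c : vec x c = \sum_i c 0 i *: b x i.
  rewrite /vec -mulmxA mulmx_sum_row; apply: eq_bigr => i _.
  by rewrite row_mul rowK.
have nU : \forall x \near x0, U x by exact: open_nbhs_nbhs.
split.
- apply: cvg_mx_entries => i j; rewrite mxE.
  have -> : (fun x => W x i j) = (fun x => s i x 0 j).
    by apply/funext => x; rewrite mxE.
  apply: cvg_mx_entry.
  have := cs i; rewrite -[_ `&` _]/(L `&` U).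
  move=> /subspace_continuousP/(_ x0 (conj Lx0 Ux0)); apply: cvg_trans.
  apply: cvg_app => P nP.
  have {}nP : \forall x \near x0, (L `&` U) x -> P x by exact: nP.
  have LP : \forall x \near x0, L x -> P x.
    by apply: filterS2 nP nU => x LUP Ux Lx; exact: LUP.
  exact: LP.
- move=> c c0; have /andP[/eqP spanE freeb] := bs x0 (conj Lx0 Ux0).
  split.
    rewrite vecE; apply: memv_suml => i _; apply: memvZ.
    by rewrite -spanE; apply: memv_span; apply/mapP; exists i; rewrite // mem_enum.
  apply: contra c0 => /eqP; rewrite vecE => c0.
  have /freeP fr : free (map_tuple (b x0) (ord_tuple r)) by [].
  apply/eqP/rowP => i; rewrite mxE; apply: (fr (fun i => c 0 i)).
  rewrite -[RHS]c0; apply: eq_bigr => j _; congr (_ *: _).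
  by rewrite -tnth_nth tnth_map tnth_ord_tuple.
- apply: filterS nU => x Ux Lx v.
  have /andP[/eqP <- _] := bs x (conj Lx Ux).
  rewrite span_def big_map big_enum => /memv_sumP[vs vsE ->].
  have /choice[c cE'] : forall i, exists k, vs i = k *: b x i.
    by move=> i; have /vlineP := vsE i isT.
  exists (\row_i c i); rewrite vecE; apply: eq_bigr => i _.
  by rewrite mxE cE'.
Qed.

End TangentDynamics.

(** * Compactness of the projectivized bundle *)
Section ProjectiveCompactness.
Context {R : realType} {d : nat} {M : smoothManifold R d}.
Variables (g : riemannianMetric M) (f : M -> M) (L : set M).
Variable E : M -> {vspace 'rV[R]_d}.
Hypotheses (f_C1 : C1_map f) (L_compact : compact L) (L_invariant : f @` L `<=` L).
Hypothesis L_noncritical : forall x, L x -> ~ critical_point f x.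
Hypotheses (E_cont : continuous_subbundle L E) (E_inv : invariant_subbundle f L E).

Let S := nonzero_vectors L E.
Let u := increment (tangent_step f) (log_norm g).

Let S_stable : forall z, S z -> S (tangent_step f z).
Proof. exact: tangent_step_stable. Qed.

Lemma growth_scale n x (k : R) (v : 'rV[R]_d) : k != 0 -> S (x, v) ->
  u n (x, k *: v) = u n (x, v).
Proof.
move=> k0 Sv; have [_ _ v0] := Sv.
have := iter_stable S_stable n Sv.
rewrite /u /increment !(iter_tangent_step f_C1) => -[_ _ /= vn0].
rewrite -scalemxAl (log_normZ _ _ k0 vn0) (log_normZ _ _ k0 v0).
by rewrite opprD addrACA subrr add0r.
Qed.

(** A property that follows from the value of one increment [u n z], whenever this
value is close to [u n z0] and [N] is large, holds with one [N] for all [z].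
Near each base point the bundle is a product of the base with a space of
coefficients.  By scale invariance of [u] it is enough to treat coefficients of
norm 1; their sphere is compact, and a covering argument over it, with the base
point as parameter, gives one [N] and one neighbourhood of the base point.
A covering argument over [L] then gives one [N] for all. *)
Lemma uniform_on_directions (Q : nat -> M * 'rV[R]_d -> Prop) :
  (forall z0, S z0 -> exists n, \forall t \near u n z0 & N \near \oo,
     forall z, S z -> u n z = t -> Q N z) ->
  exists N, forall z, S z -> Q N z.
Proof.
move=> locQ.
suff : \forall N \near \oo, L `<=` [set x | forall v, S (x, v) -> Q N (x, v)].
  move=> [N _ /(_ N (leqnn N)) LQ]; exists N => -[x v] Sz.
  by apply: LQ => //; case: Sz.
have /compact_near_coveringP := L_compact; apply => x0 Lx0.
have [r [W [Wx0 frame0 frame]]] := local_frame E_cont Lx0.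
set vec := fun (x : M) (c : 'rV[R]_r) =>
  c *m W x *m coord_change (chart_at x0) (chart_at x) x in frame0 frame.
pose G := filter_prod (within L (nbhs x0)) (@nbhs nat _ \oo).
pose P (i : M * nat) (c : 'rV[R]_r) :=
  forall k, k != 0 -> S (i.1, vec i.1 c) -> Q i.2 (i.1, k *: vec i.1 c).
have : \forall i \near G, [set c : 'rV[R]_r | `|c| = 1] `<=` P i.
  have /compact_near_coveringP := @compact_sphere R r; apply => c0 /= c01.
  have c0_neq0 : c0 != 0 by rewrite -normr_eq0 c01 oner_neq0.
  have Sz0 : S (x0, vec x0 c0) by have [] := frame0 c0 c0_neq0; split.
  have [n [[A B] /= [nA nB] AB]] := locQ _ Sz0.
  pose H := filter_prod (nbhs c0) G.
  have Hc : (fun p : 'rV[R]_r * (M * nat) => p.1) @ H --> c0 by exact: cvg_fst.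
  have HG : (fun p : 'rV[R]_r * (M * nat) => p.2) @ H --> G by exact: cvg_snd.
  have Hw : (fun p : 'rV[R]_r * (M * nat) => p.2.1) @ H --> within L (nbhs x0).
    exact: cvg_comp HG cvg_fst.
  have Hx : (fun p : 'rV[R]_r * (M * nat) => p.2.1) @ H --> x0.
    exact: cvg_trans Hw (cvg_within _).
  have HN : (fun p : 'rV[R]_r * (M * nat) => p.2.2) @ H --> \oo.
    exact: cvg_comp HG cvg_snd.
  have HW : (fun p : 'rV[R]_r * (M * nat) => p.1 *m W p.2.1) @ H --> c0 *m W x0.
    by apply: cvg_mulmx => //; exact: cvg_comp Hw Wx0.
  (* The increment is a difference of two log-norms, at times n and 0. *)
  have Hlog m : (fun p : 'rV[R]_r * (M * nat) =>
      log_norm g (iter m (tangent_step f) (p.2.1, vec p.2.1 p.1))) @ H -->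
      log_norm g (iter m (tangent_step f) (x0, vec x0 c0)).
    apply: (@log_norm_iter_cvg _ _ _ g f f_C1 _ H _ m (fun p => p.2.1)
      (fun p => p.1 *m W p.2.1) (chart_at x0)) Hx HW _.
    - exact: chart_at_atlas.
    - exact: chart_at_source.
    - by have [] := iter_stable S_stable m Sz0.
  have Hu : (fun p : 'rV[R]_r * (M * nat) => u n (p.2.1, vec p.2.1 p.1)) @ H -->
      u n (x0, vec x0 c0) by apply: cvgB; [exact: Hlog n|exact: Hlog 0%N].
  have HA : \forall p \near H, A (u n (p.2.1, vec p.2.1 p.1)) by exact: Hu _ nA.
  have HB : \forall p \near H, B p.2.2 by exact: HN _ nB.
  have : \forall p \near H, P p.2 p.1.
    apply: filterS2 HA HB => -[c [x N]] /= Ap BN k k0 Sc.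
    apply: (AB (_, _) (conj Ap BN)); last exact: growth_scale.
    case: Sc => /= Lx Ec c_neq0; split=> //=; first exact: memvZ.
    by rewrite scaler_eq0 negb_or k0.
  exact.
move=> [[A B] /= [nA nB] AB].
have nA' : \forall x \near x0, L x -> A x by exact: nA.
exists ([set x | (L x -> A x) /\
    (L x -> forall v, v \in E x -> exists c, v = vec x c)], B) => /=.
  by split=> //; exact: filterI.
move=> -[x N] /= [[LA fr] BN] v Sv; have [/= Lx Ev v0] := Sv.
have [c vc] := fr Lx v Ev.
have c0 : c != 0.
  by apply: contra v0 => /eqP c0; rewrite vc c0 /vec !mul0mx.
have nc0 : `|c| != 0 by rewrite normr_eq0.
have vE : v = `|c| *: vec x (`|c|^-1 *: c).
  by rewrite vc /vec -!scalemxAl scalerA mulfV// scale1r.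
rewrite vE; apply: (AB (x, N) (conj (LA Lx) BN)) => //=.
  by rewrite normrZ ger0_norm ?invr_ge0// mulVf.
rewrite /vec -!scalemxAl -/(vec x c) -vc; split=> //=; first exact: memvZ.
by rewrite scaler_eq0 negb_or v0 invr_eq0 nc0.
Qed.

(** Compactness is used twice: to bound the one-step increments, and to make growth
faster than a given rate uniform. *)
Lemma exists_optimal_direction : S !=set0 ->
  exists alpha,
    (exists2 z, S z & (fun n => n%:R^-1 *
       log_norm g (iter n (tangent_step f) z)) @ \oo --> alpha) /\
    (forall z lambda, S z -> (fun n => n%:R^-1 *
       log_norm g (iter n (tangent_step f) z)) @ \oo --> lambda ->
       alpha <= lambda).
Proof.
move=> S0.
have [B incB] : exists N : nat, forall z, S z -> `|u 1 z| <= N%:R.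
  apply: uniform_on_directions => z0 Sz0; exists 1%N.
  have nt : \forall t \near u 1 z0, `|u 1 z0 - t| <= 1.
    have /cvgrPdist_le := @cvg_id _ (nbhs (u 1 z0)); apply; exact: ltr01.
  exists ([set t | `|u 1 z0 - t| <= 1], [set N : nat | `|u 1 z0| + 1 <= N%:R]).
    by split=> //; exact: nbhs_infty_ger.
  move=> -[t N] /= [tu uN] z Sz ->; apply: le_trans uN.
  by rewrite -lerBlDl (le_trans (lerB_dist _ _))// distrC.
apply: (optimal_orbit S_stable S0 incB) => a fast.
(* The gain 1 / (N + 1) turns the bound on the time and the gain into a single
   property that gets weaker as N grows. *)
have [N NP] : exists N, forall z, S z -> exists n,
    [/\ (0 < n)%N, (n <= N)%N & n%:R * (a + N.+1%:R^-1) <= u n z].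
  apply: uniform_on_directions => z0 Sz0.
  have [n n0 an] := fast _ Sz0; exists n.
  (* Half of the excess of the mean growth of z0 over a; the other half is left
     for the nearby points. *)
  pose e := (u n z0 / n%:R - a) / 2.
  have nR : 0 < n%:R :> R by rewrite ltr0n.
  have ab : a < u n z0 / n%:R by rewrite ltr_pdivlMr// mulrC.
  have e0 : 0 < e by rewrite divr_gt0// subr_gt0.
  have nt : \forall t \near u n z0, n%:R * (a + e) <= t.
    apply: (@cvgr_ge _ _ (nbhs (u n z0)) _ id (u n z0)); first exact: cvg_id.
    by rewrite -ltr_pdivlMl// mulrC /e; lra.
  exists ([set t | n%:R * (a + e) <= t],
          [set N | (n <= N)%N /\ e^-1 <= N%:R]).
    split=> //=; apply: filterI; first exact: nbhs_infty_ge.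
    exact: nbhs_infty_ger.
  move=> -[t N] /= [nt' [nN eN]] z Sz ut; exists n; split=> //.
  rewrite ut; apply: le_trans nt'.
  rewrite ler_pM2l// lerD2l -[leRHS]invrK lef_pV2 ?posrE ?invr_gt0//.
  by rewrite (le_trans eN)// ler_nat.
by exists N, N.+1%:R^-1; split.
Qed.

End ProjectiveCompactness.

Theorem theorem3 (R : realType) (d : nat) (d_ge1 : (1 <= d)%N)
    (M : smoothManifold R d) (M_compact : compact [set: M])
    (g : riemannianMetric M)
    (f : M -> M) (f_C1 : C1_map f)
    (L : set M) (L_compact : compact L) (L_invariant : f @` L `<=` L)
    (L_noncritical : forall x, L x -> ~ critical_point f x)
    (E1 E2 : M -> {vspace 'rV[R]_d})
    (E_split : forall x, L x -> (E1 x + E2 x)%VS = fullv /\ directv (E1 x + E2 x))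
    (E1_continuous : continuous_subbundle L E1)
    (E2_continuous : continuous_subbundle L E2)
    (E1_invariant : invariant_subbundle f L E1)
    (E2_invariant : invariant_subbundle f L E2)
    (E1_nonzero : exists2 x, L x & E1 x <> 0%VS) :
  has_inf (lyapunov_exponents g f L E1) /\
  inf (lyapunov_exponents g f L E1) \in lyapunov_exponents g f L E1.
Proof.
have S0 : nonzero_vectors L E1 !=set0.
  have [x Lx /eqP E1x] := E1_nonzero; exists (x, vpick (E1 x)).
  by split; rewrite /= ?memv_pick ?vpick0.
have [alpha [[z Sz zalpha] alpha_le]] := exists_optimal_direction g f_C1
  L_compact L_invariant L_noncritical E1_continuous E1_invariant S0.
have averageE z' : (fun n : nat => n%:R^-1 *
      ln (riemannian_norm g (iter n f z'.1)
            (z'.2 *m tangent_map (iter n f) z'.1))) =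
    (fun n => n%:R^-1 * log_norm g (iter n (tangent_step f) z')).
  apply/funext => n; apply: (congr1 ( *%R _)).
  exact: esym (log_norm_iterE g f_C1 n z').
have alpha_in : lyapunov_exponents g f L E1 alpha.
  case: z Sz zalpha => x v [Lx Ev v0]; rewrite -averageE => cv.
  by exists x, v; split.
have alpha_lb : lbound (lyapunov_exponents g f L E1) alpha.
  move=> lambda [x [v [Lx Ev v0 cv]]].
  by apply: (alpha_le (x, v)) => //; rewrite -averageE.
split; first by split; exists alpha.
rewrite inE; suff -> : inf (lyapunov_exponents g f L E1) = alpha by [].
apply/eqP; rewrite eq_le; apply/andP; split; last first.
  by apply: lb_le_inf => //; exists alpha.
by apply: ge_inf => //; exists alpha.
Qed.
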